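(* Let $A$ be a Banach algebra, let $B$ be a Banach $A$-bimodule, and let $n\ge 0$ be an even integer. Then: (1) $B^{(n+1)}A^{(n)}\subseteq wap_\ell(B^{(n)})$ if and only if $A^{(n)}A^{(n+2)}\subseteq Z^{\ell}_{B^{(n+2)}}(A^{(n+2)})$. (2) If $A^{(n)}A^{(n+2)}\subseteq A^{(n)}Z^{\ell}_{B^{(n+2)}}(A^{(n+2)})$, then $A^{(n)}A^{(n+2)}\subseteq Z^{\ell}_{B^{(n+2)}}(A^{(n+2)})$.
   Context: For a Banach space $X$ put $X^{(0)}=X$ and $X^{(k+1)}=(X^{(k)})^*$; $X^{(k)}$ is identified with its canonical image in $X^{(k+2)}$. For a bounded bilinear map $m:X\times Y\to Z$ of normed spaces define $m^*:Z^*\times X\to Y^*$ by $\langle m^*(z',x),y\rangle=\langle z',m(x,y)\rangle$, $m^{**}=(m^* )^*:Y^{**}\times Z^*\to X^*$ and $m^{***}=(m^{**})^*:X^{**}\times Y^{**}\to Z^{**}$. For every even $k\ge 0$, $A^{(k)}$ is a Banach algebra and $B^{(k)}$ is a Banach $A^{(k)}$-bimodule, defined recursively from the given (bounded) multiplication and module actions: the multiplication (first Arens product) and the two module actions at level $k+2$ are the extensions $m^{***}$ of those at level $k$. Products are written by juxtaposition. Explicitly, for $k$ even, $a\in A^{(k)}$, $b\in B^{(k)}$, $b'\in B^{(k+1)}$, $a''\in A^{(k+2)}$, $b''\in B^{(k+2)}$: $b'a\in B^{(k+1)}$ with $\langle b'a,b\rangle=\langle b',ab\rangle$; $b''b'\in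 A^{(k+1)}$ with $\langle b''b',a\rangle=\langle b'',b'a\rangle$; $\langle a''b'',b'\rangle=\langle a'',b''b'\rangle$. A product of two sets, such as $A^{(n)}A^{(n+2)}$, $B^{(n+1)}A^{(n)}$ or $A^{(n)}Z^{\ell}_{B^{(n+2)}}(A^{(n+2)})$, denotes the linear span of the products of their elements (with $A^{(n)}\subseteq A^{(n+2)}$ where needed). $wap_\ell(B^{(n)})$ is the closed subspace of $B^{(n+1)}$ consisting of all weakly left almost periodic functionals, i.e. those $b^{(n+1)}\in B^{(n+1)}$ for which the set $\{b^{(n+1)}a^{(n)}: a^{(n)}\in A^{(n)},\ \|a^{(n)}\|\le 1\}$ is relatively weakly compact in $B^{(n+1)}$. $Z^{\ell}_{B^{(n+2)}}(A^{(n+2)})$ is the set of $a''\in A^{(n+2)}$ such that $b''\mapsto a''b''$, $B^{(n+2)}\to B^{(n+2)}$, is weak$^*$-to-weak$^*$ continuous, where weak$^*$ means $\sigma(B^{(n+2)},B^{(n+1)})$. *)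

(* Defs.v *)
From HB Require Import structures.
From mathcomp Require Import all_boot all_order all_algebra.
From mathcomp Require Import all_classical all_reals.
From mathcomp Require Import topology normedtype.
From mathcomp Require Import complex.

Set Implicit Arguments.
Unset Strict Implicit.
Unset Printing Implicit Defensive.

Import Order.TTheory GRing.Theory Num.Theory numFieldNormedType.Exports.

Local Open Scope classical_set_scope.
Local Open Scope ring_scope.

(* Banach spaces are taken over the real or the complex numbers. The library
   has no supremum in R[i], so norms of functionals are computed in R through
   [Kre] and sent back through [Kreal]. *)
Variant scalar_kind := RealScalars | ComplexScalars.

Definition scalar_field (R : realType) (k : scalar_kind) : numFieldType :=
  match k with RealScalars => R | ComplexScalars => R[i] end.

Definition Kreal (R : realType) (k : scalar_kind) : R -> scalar_field R k :=
  match k return R -> scalar_field R k with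
  | RealScalars => fun r => r
  | ComplexScalars => fun r => (r%:C)%C
  end.

Definition Kre (R : realType) (k : scalar_kind) : scalar_field R k -> R :=
  match k return scalar_field R k -> R with
  | RealScalars => fun z => z
  | ComplexScalars => fun z => complex.Re z
  end.

Section scalars.
Variables (R : realType) (k : scalar_kind).
Local Notation K := (scalar_field R k).

Lemma KrealK : cancel (@Kreal R k) (@Kre R k).
Proof. by case: k. Qed.

Lemma ler_Kreal (r s : R) : (Kreal k r <= Kreal k s) = (r <= s).
Proof. by case: k => //=; exact: lecR. Qed.

Lemma KreK (z : K) : 0 <= z -> Kreal k (Kre z) = z.
Proof.
by case: k z => //= -[a b] /=; rewrite lecE /= => /andP[/eqP -> _].
Qed.

Lemma ler_Kre (y z : K) : 0 <= y -> y <= z -> Kre y <= Kre z.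
Proof.
by move=> y0 yz; rewrite -ler_Kreal !KreK// (le_trans y0).
Qed.

End scalars.

Section dual.
Variables (R : realType) (k : scalar_kind).
Local Notation K := (scalar_field R k).
Variable X : normedModType K.

Definition continuous_functional : {pred X -> K^o} :=
  [pred f : X -> K^o | `[< linear f /\ continuous f >]].

Lemma continuous_functional_submod : submod_closed continuous_functional.
Proof.
split.
  apply/asboolP; split; last exact: cst_continuous.
  by move=> a u v; apply/esym; exact: (etrans (addr0 _) (scaler0 _ _)).
move=> a f g /asboolP[fl fc] /asboolP[gl gc]; apply/asboolP; split.
  move=> b u v; rewrite -[LHS]/(a *: f (b *: u + v) + g (b *: u + v)) fl gl.
  by rewrite !scalerDr !scalerA mulrC addrACA.
move=> x; apply: (@continuousD _ _ _ (a *: f) g); last exact: gc.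
by apply: (@continuousZl_tmp _ _ _ f a x); exact: fc.
Qed.

HB.instance Definition _ :=
  GRing.isSubmodClosed.Build K (X -> K^o) continuous_functional
    continuous_functional_submod.

Record dual : Type := Dual {
  dual_val :> X -> K^o;
  dual_valP : dual_val \in continuous_functional }.

HB.instance Definition _ := [isSub for dual_val].
HB.instance Definition _ := [Choice of dual by <:].
HB.instance Definition _ := [SubChoice_isSubLmodule of dual by <:].


Lemma dual_linear (f : dual) : linear (f : X -> K^o).
Proof. by case: f => f /= /asboolP[]. Qed.

HB.instance Definition _ (f : dual) :=
  GRing.isLinear.Build K X K^o *:%R (f : X -> K^o) (dual_linear f).

Lemma dual_continuous (f : dual) : continuous (f : X -> K^o).
Proof. by case: f => f /= /asboolP[]. Qed.

Lemma dual_eqP (f g : dual) : (forall x, f x = g x) -> f = g.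
Proof. by move=> fg; apply/val_inj/funext. Qed.

Lemma dualDE (f g : dual) x : (f + g) x = f x + g x.
Proof. by []. Qed.

Lemma dualZE a (f : dual) x : (a *: f) x = a *: f x.
Proof. by []. Qed.

Lemma dual_bounded (f : dual) : exists2 C : K, 0 <= C &
  forall x, `|f x| <= C * `|x|.
Proof.
have /linear_boundedP := continuous_linear_bounded 0 (@dual_continuous f 0).
by move=> /pinfty_ex_gt0[C C0 fC]; exists C => //; exact: ltW.
Qed.

Lemma bounded_dual (f : X -> K^o) (C : K) : linear f ->
  (forall x, `|f x| <= C * `|x|) -> f \in continuous_functional.
Proof.
move=> fl fC; apply/asboolP; split=> //.
pose F := GRing.isLinear.Build K X K^o *:%R f fl.
pose g : {linear X -> K^o} := HB.pack f F.
suff : continuous g by [].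
apply: bounded_linear_continuous; apply/bounded_funP => r.
have [C0|C0] := boolP (0 <= C).
  by exists (C * r) => x xr; apply: (le_trans (fC x)); rewrite ler_wpM2l.
exists 0 => x xr; have [->|x0] := eqVneq x 0; first by rewrite linear0 normr0.
move: (le_trans (normr_ge0 _) (fC x)); rewrite pmulr_lge0 ?normr_gt0//.
by rewrite (negbTE C0).
Qed.

Definition dual_norm (f : dual) : K :=
  Kreal k (sup [set Kre `|f x| | x in [set x : X | `|x| <= 1]]).

Lemma dual_norm_has_sup (f : dual) :
  has_sup [set Kre `|f x| | x in [set x : X | `|x| <= 1]].
Proof.
split; first by exists (Kre `|f 0|), 0 => //=; rewrite normr0.
have [C C0 fC] := dual_bounded f; exists (Kre C) => _ [x /= x1 <-].
apply: ler_Kre => //; apply: (le_trans (fC x)).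
by rewrite -[leRHS]mulr1 ler_wpM2l.
Qed.

Lemma dual_norm_ge0 (f : dual) : 0 <= dual_norm f.
Proof.
have -> : 0 = Kreal k 0 :> K by case: k.
rewrite ler_Kreal; apply: sup_upper_bound; first exact: dual_norm_has_sup.
exists 0; first by rewrite /= normr0.
by rewrite linear0 normr0; case: k.
Qed.

Lemma le_dual_norm (f : dual) (x : X) : `|f x| <= dual_norm f * `|x|.
Proof.
have [->|x0] := eqVneq x 0; first by rewrite linear0 !normr0 mulr0.
have nx0 : 0 < `|x| by rewrite normr_gt0.
rewrite -ler_pdivrMr// mulrC.
have -> : `|x|^-1 * `|f x| = `|f (`|x|^-1 *: x)|.
  by rewrite linearZ /= normrZ normfV normr_id.
rewrite -(KreK (normr_ge0 (f _))) ler_Kreal.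
apply: sup_upper_bound; first exact: dual_norm_has_sup.
by exists (`|x|^-1 *: x) => //=; rewrite normrZ normfV normr_id mulVf// gt_eqF.
Qed.

Lemma dual_norm_le (f : dual) (C : K) : 0 <= C ->
  (forall x, `|f x| <= C * `|x|) -> dual_norm f <= C.
Proof.
move=> C0 fC; rewrite -(KreK C0) ler_Kreal.
apply: ge_sup; first by case: (dual_norm_has_sup f).
move=> _ [x /= x1 <-]; apply: ler_Kre => //; apply: (le_trans (fC x)).
by rewrite -[leRHS]mulr1 ler_wpM2l.
Qed.

Lemma dual_normD f g : dual_norm (f + g) <= dual_norm f + dual_norm g.
Proof.
apply: dual_norm_le => [|x]; first by rewrite addr_ge0 ?dual_norm_ge0.
by rewrite mulrDl (le_trans (ler_normD _ _))// lerD ?le_dual_norm.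
Qed.

Lemma dual_norm_leZ a f : dual_norm (a *: f) <= `|a| * dual_norm f.
Proof.
apply: dual_norm_le => [|x]; first by rewrite mulr_ge0 ?dual_norm_ge0.
by rewrite dualZE normrZ -mulrA ler_wpM2l ?le_dual_norm.
Qed.

Lemma dual_normZ a f : dual_norm (a *: f) = `|a| * dual_norm f.
Proof.
apply/eqP; rewrite eq_le dual_norm_leZ /=.
have [->|a0] := eqVneq a 0; first by rewrite normr0 mul0r dual_norm_ge0.
rewrite -ler_pdivlMl ?normr_gt0// -normfV.
by rewrite -{1}(scalerK a0 f) dual_norm_leZ.
Qed.

Lemma dual_norm0_eq0 f : dual_norm f = 0 -> f = 0.
Proof.
move=> f0; apply: dual_eqP => x; apply/normr0_eq0/eqP.
by rewrite eq_le normr_ge0 andbT (le_trans (le_dual_norm f x))// f0 mul0r.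
Qed.

HB.instance Definition _ := Lmodule_isNormed.Build K dual
  dual_normD dual_normZ dual_norm0_eq0.

End dual.

Arguments continuous_functional {R k} X.

(* The canonical map of X into its bidual. *)
Section bidual_embedding.
Variables (R : realType) (k : scalar_kind).
Local Notation K := (scalar_field R k).
Variable X : normedModType K.

Lemma evaluation_subproof (x : X) :
  (fun f : dual X => f x : K^o) \in continuous_functional (dual X).
Proof.
apply: (@bounded_dual _ _ (dual X) _ `|x|) => [a f g //|f].
by rewrite mulrC; exact: le_dual_norm.
Qed.

Definition bidual_embedding (x : X) : dual (dual X) :=
  Dual (evaluation_subproof x).

End bidual_embedding.

Section bilinear_maps.
Variables (R : realType) (k : scalar_kind).
Local Notation K := (scalar_field R k).

Record bounded_bilinear (X Y Z : normedModType K) := BoundedBilinear {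
  bb_val :> {bilinear X -> Y -> Z};
  bb_bounded : exists C : K, forall x y, `|bb_val x y| <= C * (`|x| * `|y|) }.

Section adjoint.
Variables X Y Z : normedModType K.
Variable m : bounded_bilinear X Y Z.

Lemma bb_bounded_ge0 : exists2 C : K, 0 <= C &
  forall x y, `|m x y| <= C * (`|x| * `|y|).
Proof.
have [C mC] := bb_bounded m; exists `|C| => // x y.
have [xy0|xy0] := eqVneq (`|x| * `|y|) 0.
  by rewrite (le_trans (mC x y))// xy0 !mulr0.
have {}xy0 : 0 < `|x| * `|y| by rewrite lt_neqAle eq_sym xy0 mulr_ge0.
have C0 : 0 <= C.
  by rewrite -(pmulr_lge0 _ xy0) (le_trans _ (mC x y)).
by rewrite ger0_norm.
Qed.

Lemma adjoint_subproof (z' : dual Z) (x : X) :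
  (fun y => z' (m x y) : K^o) \in continuous_functional Y.
Proof.
have [C C0 mC] := bb_bounded_ge0.
apply: (@bounded_dual _ _ Y _ (`|z'| * (C * `|x|))) => [a u v|y].
  by rewrite !linearP.
apply: (le_trans (le_dual_norm z' (m x y))).
by rewrite -!mulrA; apply: ler_wpM2l; [exact: dual_norm_ge0|exact: mC].
Qed.

Definition adjoint_fun (z' : dual Z) (x : X) : dual Y :=
  Dual (adjoint_subproof z' x).

Lemma adjoint_bilinear : bilinear_for *:%R *:%R adjoint_fun.
Proof.
split=> [x a u v|z' a u v]; apply: dual_eqP => y //=.
by rewrite linearPl linearP.
Qed.

HB.instance Definition _ := bilinear_isBilinear.Build K (dual Z) X (dual Y)
  *:%R *:%R adjoint_fun adjoint_bilinear.

Lemma adjoint_bounded : exists C : K, forall (z' : dual Z) (x : X),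
  `|adjoint_fun z' x| <= C * (`|z'| * `|x|).
Proof.
have [C C0 mC] := bb_bounded_ge0; exists C => z' x.
apply: dual_norm_le => [|y]; first by rewrite !mulr_ge0.
apply: (le_trans (le_dual_norm z' (m x y))).
have -> : C * (`|z'| * `|x|) * `|y| = `|z'| * (C * (`|x| * `|y|)).
  by rewrite mulrCA -!mulrA.
apply: ler_wpM2l; [exact: dual_norm_ge0|exact: mC].
Qed.

(* m^* *)
Definition adjoint : bounded_bilinear (dual Z) X (dual Y) :=
  BoundedBilinear adjoint_bounded.

Lemma adjointE (z' : dual Z) (x : X) (y : Y) : adjoint z' x y = z' (m x y).
Proof. by []. Qed.

End adjoint.

(* m^*** *)
Definition arens (X Y Z : normedModType K) (m : bounded_bilinear X Y Z) :
    bounded_bilinear (dual (dual X)) (dual (dual Y)) (dual (dual Z)) :=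
  adjoint (adjoint (adjoint m)).

Fixpoint iter_dual (X : normedModType K) (n : nat) : normedModType K :=
  if n is n'.+1 then dual (iter_dual X n') else X.

(* The extension of m to level n = j.*2. *)
Fixpoint iter_arens (X Y Z : normedModType K) (m : bounded_bilinear X Y Z)
    (j : nat) : bounded_bilinear (iter_dual X j.*2) (iter_dual Y j.*2)
                                 (iter_dual Z j.*2) :=
  if j is j'.+1 then arens (iter_arens m j') else m.

End bilinear_maps.

Section banach_modules.
Variables (R : realType) (k : scalar_kind).
Local Notation K := (scalar_field R k).

Record banach_algebra (A : completeNormedModType K) := BanachAlgebra {
  alg_mul :> bounded_bilinear A A A;
  alg_mulA : forall a b c, alg_mul a (alg_mul b c) = alg_mul (alg_mul a b) c;
  alg_mul_norm : forall a b, `|alg_mul a b| <= `|a| * `|b| }.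

Record banach_bimodule (A : completeNormedModType K) (mul : banach_algebra A)
    (B : completeNormedModType K) := BanachBimodule {
  lact : bounded_bilinear A B B;
  ract : bounded_bilinear B A B;
  lactA : forall a1 a2 b, lact a1 (lact a2 b) = lact (mul a1 a2) b;
  ractA : forall b a1 a2, ract (ract b a1) a2 = ract b (mul a1 a2);
  lractA : forall a1 b a2, ract (lact a1 b) a2 = lact a1 (ract b a2) }.

Definition linear_span (V : lmodType K) (S : set V) : set V :=
  [set v | exists (n : nat) (c : 'I_n -> K) (s : 'I_n -> V),
     (forall i, S (s i)) /\ v = \sum_(i < n) c i *: s i].

Definition span_product (X Y Z : normedModType K)
    (m : bounded_bilinear X Y Z) (S : set X) (T : set Y) : set Z :=
  linear_span [set m x y | x in S & y in T].

(* The space X with its weak topology. *)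
Definition weak_space (X : normedModType K) : topologicalType :=
  initial_topology
    (fun x : X => (fun f : dual X => f x) : {ptws dual X -> K^o}).

(* The space dual X with its weak-star topology. *)
Definition weak_star_space (X : normedModType K) : topologicalType :=
  initial_topology (fun f : dual X => (f : X -> K^o) : {ptws X -> K^o}).

(* [adjoint act b' a] is b'a, since <b'a, b> = <b', ab>. *)
Definition wap_left (A B : normedModType K) (act : bounded_bilinear A B B) :
    set (dual B) :=
  [set b' | @precompact (weak_space (dual B))
     [set adjoint act b' a | a in [set a : A | `|a| <= 1]]].

(* Here Y is B^(n+1), so that dual Y is B^(n+2). *)
Definition left_topological_centre (X Y : normedModType K)
    (act : bounded_bilinear X (dual Y) (dual Y)) : set X :=
  [set a | continuous (act a : weak_star_space Y -> weak_star_space Y)].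

End banach_modules.

(* Main.v *)
Require Import Defs.
From HB Require Import structures.
From mathcomp Require Import all_boot all_order all_algebra.
From mathcomp Require Import all_classical all_reals.
From mathcomp Require Import topology normedtype.
From mathcomp Require Import complex ring lra.

(** Write X = A^(n) and Y = B^(n). Both sides of (1) say that certain scalar
    functions on Y^** are evaluations at a point of Y^*. Call (x'', y')
    represented when y'' |-> <x''y'', y'> is such an evaluation.

    - x'' lies in the topological centre iff (x'', y') is represented for every
      y' ([left_topological_centreP]): continuity into a weak-star topology is
      tested on the functionals y', and a weak-star continuous linear functional
      on a dual space is an evaluation ([weak_star_continuous_functional]).

    - y' is weakly left almost periodic iff (x'', y') is represented for every
      x'' ([wap_leftP]). This is Gantmacher's criterion for T : a |-> y'a, whose
      second adjoint sends x'' to y'' |-> <x''y'', y'>: T is weakly compact iff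
      T^** maps X^** into Y^*. If T^** does so, it is continuous from the
      weak-star topology to the weak topology of Y^*, so the image of the unit
      ball of X^**, compact by [banach_alaoglu], is a weakly compact set that
      contains y'a for |a| <= 1. Conversely, after scaling x'' into the unit
      ball, [goldstine] gives a filter on the unit ball of X that converges to
      x'' weak-star, at least in real parts; a weak cluster point of its image
      under T represents (x'', y').

    The two conditions are exchanged by <(ax'')y'', y'> = <x''y'', y'a>, that is
    (ax'', y') is represented iff (x'', y'a) is ([represented_mul]); this is the
    associativity of the action, which passes through the Arens extension
    ([arens_action]). Being represented is linear in each variable, so linear
    spans may be replaced by the products that generate them, and (1) follows.
    For (2), when z is in the centre and a in X, the pair (z, y'a) is
    represented for every y', hence so is (az, y'): X times the centre is
    contained in the centre. *)

Set Implicit Arguments.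
Unset Strict Implicit.
Unset Printing Implicit Defensive.

Import Order.TTheory GRing.Theory Num.Theory numFieldNormedType.Exports.

Local Open Scope classical_set_scope.
Local Open Scope ring_scope.

(** * Real parts and closed discs of the scalar field *)

Section scalars.
Variables (R : realType) (k : scalar_kind).
Local Notation K := (scalar_field R k).

Lemma KreD (y z : K) : Kre (y + z) = Kre y + Kre z.
Proof. by case: k y z => //= -[a b] [c d]. Qed.

Lemma KreN (z : K) : Kre (- z) = - Kre z.
Proof. by case: k z => //= -[a b]. Qed.

Lemma KreB (y z : K) : Kre (y - z) = Kre y - Kre z.
Proof. by rewrite KreD KreN. Qed.

Lemma Kre0 : Kre (0 : K) = 0.
Proof. by case: k. Qed.

Lemma Kre1 : Kre (1 : K) = 1.
Proof. by case: k. Qed.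

Lemma Kre_sum (I : Type) (r : seq I) (F : I -> K) :
  Kre (\sum_(i <- r) F i) = \sum_(i <- r) Kre (F i).
Proof. exact: (big_morph _ KreD Kre0). Qed.

Lemma KreZ (r : R) (z : K) : Kre (Kreal k r * z) = r * Kre z.
Proof. by case: k z => //= -[a b] /=; rewrite mul0r subr0. Qed.

Lemma normr_Kre_le (z : K) : `|Kre z| <= Kre `|z|.
Proof.
case: k z => //= -[a b] /=.
by rewrite -sqrtr_sqr ler_wsqrtr// lerDl sqr_ge0.
Qed.

Lemma Kre_le_norm (z : K) : Kre z <= Kre `|z|.
Proof. exact: le_trans (ler_norm _) (normr_Kre_le z). Qed.

(** Real parts alone separate scalars once all multiples are tested, so real
    arguments suffice over both scalar fields. *)
Lemma Kre_sep (y z : K) : (forall c : K, Kre (c * y) = Kre (c * z)) -> y = z.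
Proof.
move=> yz; apply/eqP; rewrite -subr_eq0; apply/negPn/negP => yz0.
have /eqP := yz (y - z)^-1; rewrite -subr_eq0 -KreB -mulrBr mulVf// Kre1.
by rewrite oner_eq0.
Qed.

Lemma ltr_Kreal (r s : R) : (Kreal k r < Kreal k s) = (r < s).
Proof. by case: k => //=; exact: ltcR. Qed.

Lemma Kreal_gt0 (r : R) : 0 < r -> 0 < Kreal k r.
Proof. by case: k => //= r0; rewrite ltcE /= eqxx. Qed.

Lemma Kre_continuous : continuous (@Kre R k : K^o -> R^o).
Proof.
move=> z; apply/(@cvgrPdist_lt _ R^o K^o (nbhs z)) => e e0.
apply/nbhs_normP; exists (Kreal k e); first exact: Kreal_gt0.
move=> w /= zw; rewrite -KreB (le_lt_trans (normr_Kre_le _))//.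
by rewrite -ltr_Kreal KreK.
Qed.

Lemma Kre_norm_continuous : continuous (fun z : K^o => Kre `|z|).
Proof.
move=> z; apply: continuous_comp; last exact: Kre_continuous.
exact: norm_continuous.
Qed.

Lemma Kreal_continuous : continuous (@Kreal R k : R^o -> K^o).
Proof.
move=> x; apply/(@cvgrPdist_lt _ K^o R^o (nbhs x)) => e e0.
apply/nbhs_normP; exists (Kre e).
  by rewrite /= -ltr_Kreal KreK ?ltW//; case: k e e0.
move=> y /= xy; rewrite -(KreK (ltW e0)).
rewrite -(KreK (normr_ge0 (_ - _))) ltr_Kreal; apply: le_lt_trans xy.
case: k => //=.
by rewrite oppr0 addr0 expr0n addr0 sqrtr_sqr.
Qed.
End scalars.

Section closed_disc.
Variables (R : realType) (k : scalar_kind).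
Local Notation K := (scalar_field R k).

(** Over the complex numbers the disc is a closed part of the image of a
    product of two segments. *)
Lemma compact_closed_disc (r : K) : compact [set z : K^o | `|z| <= r].
Proof.
have cl : closed [set z : K^o | `|z| <= r].
  have [r0|r0] := boolP (0 <= r).
    have -> : [set z : K^o | `|z| <= r] =
        (fun z : K^o => Kre `|z|) @^-1` [set x | x <= Kre r].
      by apply/seteqP; split => z /=; rewrite -(ler_Kreal k) !KreK.
    apply: preimage_closed; last exact: closed_le.
    by move=> z _; exact: Kre_norm_continuous.
  rewrite (_ : mkset _ = set0); first exact: closed0.
  apply/seteqP; split => // z /= zr.
  by rewrite (le_trans _ zr) in r0.
have Kr (z : K) : `|z| <= r -> Kre `|z| <= Kre r by apply: ler_Kre.
case: k r cl Kr => /= r cl Kr.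
  apply: (subclosed_compact cl (@segment_compact R (- r) r)).
  by move=> z /=; rewrite in_itv /= ler_norml.
pose f (p : R^o * R^o) : (R[i])^o := (p.1)%:C%C + 'i%C * (p.2)%:C%C.
have fc : continuous f.
  move=> p.
  apply: (@cvgD _ (R[i])^o _ _ _ (fun q : R^o * R^o => (q.1)%:C%C)
    (fun q => 'i%C * (q.2)%:C%C)).
    apply: (@continuous_comp _ _ _ fst (@Kreal R ComplexScalars)).
      exact: cvg_fst.
    exact: Kreal_continuous.
  apply: (@cvgMl_tmp _ _ _ _ (fun q : R^o * R^o => (q.2)%:C%C)).
  apply: (@continuous_comp _ _ _ snd (@Kreal R ComplexScalars)).
    exact: cvg_snd.
  exact: Kreal_continuous.
pose I : set R^o := `[- complex.Re r, complex.Re r]%classic.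
have cI : compact I by exact: segment_compact.
apply: (subclosed_compact cl (continuous_compact (continuous_subspaceT fc)
  (compact_setX cI cI))).
move=> z /= zr; have zr' := Kr z zr.
have Iz : I (complex.Re z) /\ I (complex.Im z).
  rewrite /I /= !in_itv /= -!ler_norml; split.
    exact: le_trans (@normr_Kre_le R ComplexScalars z) zr'.
  apply: le_trans zr'; case: (z) => a b /=.
  by rewrite -sqrtr_sqr ler_wsqrtr// lerDr sqr_ge0.
exists (complex.Re z, complex.Im z) => //.
by rewrite /f/= -complexE.
Qed.

End closed_disc.

(** * Weak and weak-star topologies *)

Section initial_topologies.

Lemma cvg_ptws (T : Type) (V : topologicalType) (F : set_system {ptws T -> V})
    (f : {ptws T -> V}) : Filter F ->
  (forall t, (fun g : {ptws T -> V} => g t) @ F --> f t) -> F --> f.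
Proof.
move=> FF Ff; apply/cvg_sup => t; apply/cvg_image.
  by apply/seteqP; split => // v _; exists (fun=> v).
move=> A /(Ff t) FA; exists ((fun g : {ptws T -> V} => g t) @^-1` A) => //.
by apply/seteqP; split => [_ [g /= + <-] //|v Av]; exists (fun=> v).
Qed.

Lemma eval_ptws_continuous (T : Type) (V : topologicalType) (t : T) :
  continuous (fun g : {ptws T -> V} => g t).
Proof.
move=> g; have /cvg_sup/(_ t)/cvg_image : g --> g by exact: cvg_id.
move=> h; apply: cvg_trans (h _) => {h}.
  by move=> Q /= [W nbdW <-]; apply: filterS nbdW; exact: preimage_image.
by apply/seteqP; split => // v _; exists (fun=> v).
Qed.

Lemma cvg_initial (S : choiceType) (T : topologicalType) (i : S -> T)
    (F : set_system (initial_topology i)) (s : initial_topology i) :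
  Filter F -> i @ F --> i s -> F --> s.
Proof.
move=> FF iF U [_ [[W oW <-] Ws] WU].
by apply: (filterS WU); apply: iF; exact: open_nbhs_nbhs.
Qed.

End initial_topologies.

Section weak_topologies.
Variables (R : realType) (k : scalar_kind).
Local Notation K := (scalar_field R k).
Variable X : normedModType K.

Lemma weak_star_eval_continuous (x : X) :
  continuous (fun g : weak_star_space X => (g : dual X) x : K^o).
Proof.
move=> f; apply: (@continuous_comp _ _ _ _ (fun g : {ptws X -> K^o} => g x)).
  exact: initial_continuous.
exact: eval_ptws_continuous.
Qed.

Lemma weak_eval_continuous (f : dual X) :
  continuous (fun y : weak_space X => f y : K^o).
Proof.
pose i (x : X) : {ptws dual X -> K^o} := fun g : dual X => g x.
move=> x; apply: (@continuous_comp (weak_space X) _ _ i (fun g => g f)).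
  exact: (@initial_continuous X _ i).
exact: eval_ptws_continuous.
Qed.

Lemma cvg_weak_star (F : set_system (weak_star_space X))
    (f : weak_star_space X) : Filter F ->
  (forall x, (fun g : weak_star_space X => (g : dual X) x : K^o) @ F -->
    ((f : dual X) x : K^o)) -> F --> f.
Proof.
by move=> FF Ff; apply: cvg_initial; apply: cvg_ptws => x; exact: Ff.
Qed.

Lemma continuous_to_weak_star (T : topologicalType)
    (g : T -> weak_star_space X) :
  (forall x, continuous (fun t => (g t : dual X) x : K^o)) -> continuous g.
Proof. by move=> gc t; apply: cvg_weak_star => x; exact: gc. Qed.

Lemma continuous_to_weak (T : topologicalType) (g : T -> weak_space X) :
  (forall f : dual X, continuous (fun t => f (g t) : K^o)) -> continuous g.
Proof.
by move=> gc t; apply: cvg_initial; apply: cvg_ptws => f; exact: gc.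
Qed.

End weak_topologies.

Section weak_star_functionals.
Variables (R : realType) (k : scalar_kind).
Local Notation K := (scalar_field R k).
Variable X : normedModType K.

(** Induction on s. If some g vanishes on the tail of s but not at its head x0,
    subtracting from phi a multiple of the evaluation at x0 gives a functional
    that vanishes where the tail does; otherwise phi already is one. *)
Lemma functional_vanishing_on_annihilator (s : seq X) (phi : dual X -> K^o) :
  linear phi ->
  (forall f : dual X, (forall x, x \in s -> f x = 0) -> phi f = 0) ->
  exists x, forall f : dual X, phi f = f x.
Proof.
elim: s phi => [|x0 s IH] phi phil phi0.
  by exists 0 => f; rewrite linear0 phi0.
have [[g [gs gx0]]|ns] := pselect
    (exists g : dual X, (forall x, x \in s -> g x = 0) /\ g x0 != 0);
    last first.
  apply: (IH phi phil) => f fs; apply: phi0 => x.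
  rewrite inE => /predU1P[->|/fs//]; apply/eqP/negPn/negP => fx0.
  by apply: ns; exists f.
pose L := GRing.isLinear.Build K (dual X) K^o *:%R phi phil.
pose Phi : {linear dual X -> K^o} := HB.pack phi L.
pose c : K := (g x0)^-1 * phi g.
pose psi (f : dual X) : K^o := phi f - f x0 * c.
have [||x psix] := IH psi.
- move=> a f h.
  have rearrange (p q u v d : K) :
      a * p + q - (a * u + v) * d = a * (p - u * d) + (q - v * d).
    by rewrite mulrBr mulrA mulrDl opprD addrACA.
  by rewrite /psi phil; exact: rearrange.
- move=> f fs; pose d : K := f x0 / g x0.
  have dE x : (f - d *: g) x = f x - d * g x by [].
  have : Phi (f - d *: g) = 0.
    apply: phi0 => x; rewrite inE dE => /predU1P[->|xs].
      by rewrite divfK// subrr.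
    by rewrite fs// gs// mulr0 subrr.
  rewrite linearB linearZ /= => /eqP; rewrite subr_eq0 => /eqP phif.
  by rewrite /psi phif /c mulrA subrr.
by exists (x + c *: x0) => f; rewrite linearD linearZ/= -psix /psi mulrC subrK.
Qed.

(** The annihilators of finite sets of vectors form a base of a filter that
    tends weak-star to 0. So phi is bounded by 1 on one of these subspaces, and
    a linear form bounded on a subspace is zero there. *)
Lemma weak_star_continuous_functional (phi : dual X -> K^o) :
  linear phi -> continuous (phi : weak_star_space X -> K^o) ->
  exists x, forall f : dual X, phi f = f x.
Proof.
move=> phil phic.
pose N (s : seq X) := [set f : weak_star_space X |
  forall x, x \in s -> (f : dual X) x = 0].
pose F : set_system (weak_star_space X) := filter_from setT N.
have FF : Filter F.
  apply: filter_from_filter; first by exists [::].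
  move=> s t _ _; exists (s ++ t) => // f fst; split => x xs; apply: fst;
  by rewrite mem_cat xs ?orbT.
have F0 : cvg_to F (@nbhs _ (weak_star_space X) (0 : dual X)).
  apply: cvg_weak_star => x A A0.
  exists [:: x] => // f fx /=; rewrite /= fx ?mem_head//; exact: nbhs_singleton.
pose L := GRing.isLinear.Build K (dual X) K^o *:%R phi phil.
pose Phi : {linear dual X -> K^o} := HB.pack phi L.
have phi0 : phi 0 = 0 by exact: (linear0 Phi).
have near1 : nbhs (phi 0 : K^o) [set z : K^o | `|z| < 1].
  apply/nbhs_normP; exists 1; first by rewrite /= ltr01.
  by move=> z; rewrite /= phi0 sub0r normrN.
have /F0[s _ sN] := phic (0 : dual X) _ near1.
apply: (functional_vanishing_on_annihilator (s := s) phil) => f fs.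
apply/eqP/negPn/negP => phif0.
have /sN /= : N s ((phi f)^-1 *: f).
  move=> x xs; rewrite -[LHS]/((phi f)^-1 * f x).
  by rewrite fs// mulr0.
have -> : phi ((phi f)^-1 *: f) = (phi f)^-1 * phi f by exact: (linearZ_LR Phi).
by rewrite mulVf// normr1 ltxx.
Qed.
End weak_star_functionals.

(** * Weak-star compactness of the dual ball *)

(** The image of an ultrafilter decides every set W or its complement, so a
    cluster point of it is a limit. *)
Lemma ultra_compact_cvg (T : Type) (U : topologicalType) (F : set_system T)
    (h : T -> U) (A : set U) : UltraFilter F -> compact A -> F (h @^-1` A) ->
  exists2 l, A l & h @ F --> l.
Proof.
move=> FU cA FA; have [l [Al hl]] := cA (h @ F) _ FA.
exists l => // W Wl; have [//|FnW] := in_ultra_setVsetC (h @^-1` W) FU.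
by have [v [/= nWv Wv]] := hl (~` W) W FnW Wl.
Qed.

Section dual_ball.
Variables (R : realType) (k : scalar_kind).
Local Notation K := (scalar_field R k).
Variable X : normedModType K.

(** An ultrafilter on the ball converges at each vector x, since its values lie
    in the compact disc of radius |x|; the pointwise limit is linear and of norm
    at most 1. *)
Lemma banach_alaoglu :
  compact ([set f : dual X | `|f| <= 1] : set (weak_star_space X)).
Proof.
rewrite compact_ultra => F FU FB.
have lim (x : X) : exists2 l : K^o, `|l| <= `|x| &
    (fun g : weak_star_space X => (g : dual X) x : K^o) @ F --> l.
  apply: (ultra_compact_cvg FU (@compact_closed_disc R k `|x|)).
  apply: filterS FB => f /= f1; apply: (le_trans (le_dual_norm f x)).
  by rewrite -[leRHS]mul1r ler_wpM2r.
pose f x := sval (cid2 (lim x)).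
have fle x : `|f x| <= 1 * `|x| by rewrite mul1r /f; case: cid2.
have flim x : (fun g : weak_star_space X => (g : dual X) x : K^o) @ F --> f x.
  by rewrite /f; case: cid2.
have flin : linear f.
  move=> a u v.
  pose h (g : weak_star_space X) : K^o := (g : dual X) (a *: u + v).
  have hlim : h @ F --> (a *: f u + f v : K^o).
    have -> : h = (fun g : weak_star_space X =>
        a *: ((g : dual X) u : K^o) + ((g : dual X) v : K^o)).
      by apply/funext => g; exact: (dual_linear g).
    have au : (fun g : weak_star_space X => a *: ((g : dual X) u : K^o)) @ F -->
        (a *: f u : K^o).
      exact: (cvgZl_tmp (flim u)).
    exact: (cvgD au (flim v)).
  apply: (cvg_unique (@norm_hausdorff _ K^o) _ hlim).
  exact: flim.
pose g : dual X := Dual (bounded_dual flin fle).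
exists g; split; last by apply: cvg_weak_star => x; exact: flim.
by apply: dual_norm_le.
Qed.
End dual_ball.

(** * Weak-star density of the ball in the bidual ball *)

Section goldstine.
Variables (R : realType) (k : scalar_kind).
Local Notation K := (scalar_field R k).
Variable X : normedModType K.

(** Rotating c by a scalar of modulus 1 turns g c into its modulus. *)
Lemma dual_norm_le_Kre (g : dual X) (L : R) :
  (forall c : X, `|c| <= 1 -> Kre (g c) <= L) -> Kre `|g| <= L.
Proof.
move=> gL; rewrite [`|g|]/(dual_norm g) /dual_norm KrealK.
apply: ge_sup; first by case: (dual_norm_has_sup g).
move=> _ [c /= c1 <-].
have [gc0|gc0] := eqVneq (g c) 0.
  rewrite gc0 normr0 Kre0 (_ : 0 = Kre (g 0)) ?gL ?normr0//.
  by rewrite linear0 Kre0.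
have -> : `|g c| = g ((`|g c| / g c) *: c).
  by rewrite linearZ /= -[_ *: _]/(`|g c| / g c * g c) divfK.
apply: gL; rewrite normrZ normf_div normr_id divff ?mul1r//.
by rewrite normr_eq0.
Qed.

Lemma dual_sumE (I : Type) (r : seq I) (F : I -> dual X) (x : X) :
  (\sum_(i <- r) F i) x = \sum_(i <- r) F i x :> K.
Proof. by apply: (big_morph (fun f : dual X => f x : K)). Qed.

Lemma segment_in_unit_ball (a c : X) (t : R) : `|a| <= 1 -> `|c| <= 1 ->
  0 <= t -> t <= 1 -> `|a + Kreal k t *: (c - a)| <= 1.
Proof.
move=> a1 c1 t0 t1.
have K1 : Kreal k 1 = 1 by case: k.
have K0 : Kreal k 0 = 0 by case: k.
have t0' : 0 <= Kreal k t by rewrite -K0 ler_Kreal.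
have t1' : 0 <= 1 - Kreal k t by rewrite subr_ge0 -K1 ler_Kreal.
have -> : a + Kreal k t *: (c - a) = (1 - Kreal k t) *: a + Kreal k t *: c.
  by rewrite scalerBl scalerBr scale1r addrAC addrA.
apply: (le_trans (ler_normD _ _)); rewrite !normrZ !ger0_norm//.
apply: (le_trans (lerD (ler_wpM2l t1' a1) (ler_wpM2l t0' c1))).
by rewrite !mulr1 subrK.
Qed.

Variable x'' : dual (dual X).
Hypothesis x''1 : `|x''| <= 1.

Definition dist2 (s : seq (dual X)) (a : X) : R :=
  \sum_(f <- s) (Kre (f a) - Kre (x'' f)) ^+ 2.

(** The separation argument of Goldstine's theorem, made quantitative so that no
    minimum has to be attained. Let w_f = Re x''(f) - Re f(a), and let g be the
    combination of the f in s with coefficients w_f. Moving from a towards c by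
    the fraction t changes dist2 by -2t Re g(c - a) + O(t^2); as a is almost
    minimal, Re g(c) <= Re g(a) + O(t) on the unit ball, so the norm of g obeys
    the same bound. Now Re x''(g) is at most that norm, while
    dist2 s a = Re x''(g) - Re g(a). *)
Lemma dist2_near_minimum (s : seq (dual X)) (D t : R) (a : X) :
  `|a| <= 1 -> 0 < t -> t <= 1 ->
  (forall b : X, `|b| <= 1 -> D <= dist2 s b) -> dist2 s a <= D + t ^+ 2 ->
  dist2 s a <= t * (1 + \sum_(f <- s) (2 * Kre `|f|) ^+ 2) / 2.
Proof.
move=> a1 t0 t1 Dmin aD.
pose M : R := \sum_(f <- s) (2 * Kre `|f|) ^+ 2.
pose w f : R := Kre (x'' f) - Kre (f a).
pose g : dual X := \sum_(f <- s) Kreal k (w f) *: f.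
have gE c : Kre (g c) = \sum_(f <- s) w f * Kre (f c).
  rewrite dual_sumE Kre_sum; apply: eq_bigr => f _.
  by rewrite -KreZ.
have x''g : Kre (x'' g) = \sum_(f <- s) w f * Kre (x'' f).
  rewrite linear_sum Kre_sum; apply: eq_bigr => f _.
  by rewrite linearZ -KreZ.
have distE : dist2 s a = Kre (x'' g) - Kre (g a).
  rewrite x''g gE -sumrB; apply: eq_bigr => f _; rewrite /w; ring.
have f1 (f : dual X) (c : X) : `|c| <= 1 -> `|Kre (f c)| <= Kre `|f|.
  move=> c1; apply: (le_trans (normr_Kre_le _)); apply: ler_Kre => //.
  apply: (le_trans (le_dual_norm f c)).
  by rewrite -[leRHS]mulr1 ler_wpM2l ?dual_norm_ge0.
(* Compares dist2 at a and at the point a + t (c - a) of the ball. *)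
have step c : `|c| <= 1 -> Kre (g c) <= Kre (g a) + t * (1 + M) / 2.
  move=> c1; have b1 := segment_in_unit_ball a1 c1 (ltW t0) t1.
  have := le_trans aD (lerD (Dmin _ b1) (lexx _)).
  pose S : R := \sum_(f <- s) w f * (Kre (f c) - Kre (f a)).
  pose Q : R := \sum_(f <- s) (Kre (f c) - Kre (f a)) ^+ 2.
  have -> : dist2 s (a + Kreal k t *: (c - a)) =
      dist2 s a - 2 * t * S + t ^+ 2 * Q.
    rewrite /dist2 /S /Q !mulr_sumr -sumrB -big_split; apply: eq_bigr => f _ /=.
    rewrite linearD linearZ linearB /= KreD -[_ *: _]/(Kreal k t * (f c - f a)).
    rewrite KreZ KreB /w; ring.
  have QM : Q <= M.
    apply: ler_sum => f _; rewrite -[leLHS]real_normK ?num_real//.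
    rewrite ler_sqr ?nnegrE ?mulr_ge0//.
      by rewrite (le_trans (ler_normB _ _))// mulrC mulr_natr mulr2n lerD// f1.
    exact: le_trans (normr_ge0 _) (f1 f a a1).
  have -> : Kre (g c) = Kre (g a) + S.
    rewrite !gE -big_split; apply: eq_bigr => f _ /=; ring.
  rewrite lerD2l => H.
  have : t * (2 * S) <= t * (t * (1 + M)).
    have := ler_wpM2l (sqr_ge0 t) QM; lra.
  by rewrite ler_pM2l//; lra.
have gL := dual_norm_le_Kre step.
rewrite distE lerBlDl; apply: le_trans gL.
apply: (le_trans (Kre_le_norm _)); apply: ler_Kre => //.
apply: (le_trans (le_dual_norm x'' g)).
by rewrite -[leRHS]mul1r ler_wpM2r ?dual_norm_ge0.
Qed.

(** By [dist2_near_minimum] the infimum of dist2 over the unit ball is zero. *)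
Lemma goldstine (s : seq (dual X)) (e : R) : 0 < e ->
  exists2 a : X, `|a| <= 1 &
    forall f, f \in s -> `|Kre (f a) - Kre (x'' f)| < e.
Proof.
move=> e0; pose V : set R := [set dist2 s a | a in [set a : X | `|a| <= 1]].
have V0 : V !=set0 by exists (dist2 s 0), 0 => //=; rewrite normr0.
have Vge0 : lbound V 0.
  by move=> _ [a _ <-]; apply: sumr_ge0 => f _; exact: sqr_ge0.
have Vinf : has_inf V by split => //; exists 0.
have Dmin (b : X) : `|b| <= 1 -> inf V <= dist2 s b.
  by move=> b1; apply: ge_inf; [exists 0|exists b].
pose M : R := \sum_(f <- s) (2 * Kre `|f|) ^+ 2.
have M0 : 0 <= M by apply: sumr_ge0 => f _; exact: sqr_ge0.
(* This t is at most 1, and small enough for t (1 + M) / 2 < e ^+ 2. *)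
pose t : R := e ^+ 2 / (1 + M + e ^+ 2).
have e20 : 0 < e ^+ 2 by rewrite exprn_gt0.
have t0 : 0 < t by rewrite divr_gt0//; lra.
have t1 : t <= 1 by rewrite ler_pdivrMr; lra.
have [_ [a a1 <-] aD] := inf_adherent (exprn_gt0 2 t0) Vinf.
exists a => // f fs.
have := dist2_near_minimum a1 t0 t1 Dmin (ltW aD); rewrite -/M => dle.
have dlt : dist2 s a < e ^+ 2.
  have : t * (1 + M) <= e ^+ 2.
    rewrite /t mulrAC ler_pdivrMr; last by lra.
    by rewrite ler_pM2l//; lra.
  lra.
rewrite -ltr_sqr ?nnegrE ?(ltW e0)// real_normK ?num_real//.
apply: le_lt_trans dlt; rewrite /dist2 (big_rem f)//= lerDl.
by apply: sumr_ge0 => h _; exact: sqr_ge0.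
Qed.

End goldstine.

(** * Almost periodicity and the topological centre *)

Section represented.
Variables (R : realType) (k : scalar_kind).
Local Notation K := (scalar_field R k).

Lemma linear_span_sub (V : lmodType K) (S P : set V) : P 0 ->
  (forall a u v, P u -> P v -> P (a *: u + v)) -> S `<=` P ->
  linear_span S `<=` P.
Proof.
move=> P0 PL SP _ [n [c [s [Ss ->]]]].
apply: (big_ind P) => // [u v Pu Pv|i _].
  by rewrite -[u]scale1r; exact: PL.
by rewrite -[_ *: _]addr0; apply: PL => //; exact: SP.
Qed.

Section bilinear_map.
Variables X Y Z : normedModType K.
Variable m : bounded_bilinear X Y Z.

(** In terms of T : a |-> m^*(z', a), from X to Y^*: the value of T^** at x''
    belongs to Y^*, seen as a subspace of Y^***. *)
Definition represented (x'' : dual (dual X)) (z' : dual Z) : Prop :=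
  exists y' : dual Y, forall y'' : dual (dual Y), arens m x'' y'' z' = y'' y'.

Lemma represented0l z' : represented 0 z'.
Proof. by exists 0 => y''; rewrite linear0. Qed.

Lemma represented0r x'' : represented x'' 0.
Proof. by exists 0 => y''; rewrite !linear0. Qed.

Lemma representedDl a x1 x2 z' : represented x1 z' -> represented x2 z' ->
  represented (a *: x1 + x2) z'.
Proof.
move=> [u uE] [v vE]; exists (a *: u + v) => y''.
by rewrite [RHS]linearP /= -uE -vE.
Qed.

Lemma representedDr a x'' z1 z2 : represented x'' z1 -> represented x'' z2 ->
  represented x'' (a *: z1 + z2).
Proof.
move=> [u uE] [v vE]; exists (a *: u + v) => y''.
rewrite [LHS]linearP -[LHS]/(a * arens m x'' y'' z1 + arens m x'' y'' z2) uE vE.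
by rewrite [RHS]linearP.
Qed.

Lemma weak_dual_hausdorff (V : normedModType K) :
  hausdorff_space (weak_space (dual V)).
Proof.
move=> f g fg; apply: dual_eqP => v.
apply: (@norm_hausdorff _ K^o) => A B Af Bg.
have ev := @weak_eval_continuous R k (dual V) (bidual_embedding v).
by have [h [Ah Bh]] := fg _ _ (ev f _ Af) (ev g _ Bg); exists (h v).
Qed.

(** The representing functional is a weak cluster point of the m^*(z', a), as a
    runs along a filter on the unit ball that converges to x'' in real parts;
    the filter exists by [goldstine]. *)
Lemma represented_of_precompact x'' z' : `|x''| <= 1 ->
  @precompact (weak_space (dual Y))
    [set adjoint m z' a | a in [set a : X | `|a| <= 1]] ->
  represented x'' z'.
Proof.
move=> x1 [U TU [cU _]].
pose T (a : X) : weak_space (dual Y) := adjoint m z' a.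
pose N (p : seq (dual X) * R) := [set a : X | `|a| <= 1 /\
  forall f, f \in p.1 -> `|Kre (f a) - Kre (x'' f)| < p.2].
pose G : set_system X := filter_from [set p : seq (dual X) * R | 0 < p.2] N.
have GG : ProperFilter G.
  apply: filter_from_proper; last first.
    by move=> [s e] /= e0; have [a a1 ax] := goldstine x1 s e0; exists a.
  apply: filter_from_filter; first by exists ([::], 1) => /=.
  move=> [s e] [t d] /= e0 d0; exists (s ++ t, Num.min e d) => /=.
    by rewrite lt_min e0.
  move=> a [a1 H]; split; split => // f fs /=;
  have := H f; rewrite /= mem_cat fs ?orbT lt_min => /(_ isT)/andP[] //.
have GU : (T @ G) U.
  by exists ([::], 1) => //= a [a1 _]; apply: TU; exists a.
have [z [Uz zcl]] := cU (T @ G) _ GU.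
(* The filter controls real parts only, hence the arbitrary multiple of y''. *)
exists z => y''; apply: Kre_sep => c.
pose h : dual X := adjoint (adjoint m) (c *: y'') z'.
have hE : c * arens m x'' y'' z' = x'' h.
  rewrite -[RHS]/(arens m x'' (c *: y'') z').
  by rewrite linearZr.
have yE : c * y'' z = (c *: y'') z by [].
rewrite hE yE; apply/eqP; rewrite -subr_eq0 -normr_le0.
apply/ler_addgt0Pr => e e0.
have e2 : 0 < e / 2 by rewrite divr_gt0.
have A : (T @ G) (T @` N ([:: h], e / 2)).
  by exists ([:: h], e / 2) => // a Na; exists a.
have B : nbhs z [set y : weak_space (dual Y) |
    `|Kre ((c *: y'') z) - Kre ((c *: y'') y)| < e / 2].
  have := continuous_comp (@weak_eval_continuous R k (dual Y) (c *: y'') z)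
    (@Kre_continuous R k _).
  by move/cvgr_dist_lt => /(_ _ e2).
have [_ [[a [a1 Na] <-] /= Ba]] := zcl _ _ A B.
have ha : `|Kre ((c *: y'') (T a)) - Kre (x'' h)| < e / 2
  := Na h (mem_head _ _).
rewrite add0r distrC [e]splitr.
rewrite (le_trans (ler_distD (Kre ((c *: y'') (T a))) _ _))//.
by apply: lerD; apply: ltW.
Qed.

(** Choosing representatives gives a map g from X^** to Y^* that is continuous
    from the weak-star to the weak topology, since y'' o g is evaluation at
    m^**(y'', z'). The compact image of the bidual ball under g contains each
    m^*(z', a) with |a| <= 1. *)
Lemma precompact_of_represented z' :
  (forall x'', represented x'' z') ->
  @precompact (weak_space (dual Y))
    [set adjoint m z' a | a in [set a : X | `|a| <= 1]].
Proof.
move=> rep; pose g x'' : dual Y := sval (cid (rep x'')).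
have gE x'' (y'' : dual (dual Y)) :
    y'' (g x'') = x'' (adjoint (adjoint m) y'' z').
  by rewrite /g; case: cid => y' /= <-.
have gc : continuous (g : weak_star_space (dual X) -> weak_space (dual Y)).
  apply: continuous_to_weak => y''.
  have -> : (fun f : weak_star_space (dual X) => y'' (g f) : K^o) =
      (fun f : weak_star_space (dual X) =>
        (f : dual (dual X)) (adjoint (adjoint m) y'' z')).
    by apply/funext => f; rewrite gE.
  exact: weak_star_eval_continuous.
apply: precompact_subset (compact_precompact (@weak_dual_hausdorff Y)
  (continuous_compact (continuous_subspaceT gc)
    (@banach_alaoglu R k (dual X)))).
move=> _ [a a1 <-]; exists (bidual_embedding a).
  apply: dual_norm_le => // f; rewrite mul1r.
  apply: (le_trans (le_dual_norm f a)).
  by rewrite -[leRHS]mulr1 ler_wpM2l// dual_norm_ge0.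
apply: dual_eqP => y; exact: (gE _ (bidual_embedding y)).
Qed.
End bilinear_map.

Lemma wap_leftP (X Y : normedModType K) (act : bounded_bilinear X Y Y) z' :
  wap_left act z' <-> forall x'', represented act x'' z'.
Proof.
split=> [wap x''|]; last exact: precompact_of_represented.
(* Adding 1 keeps the scaling factor nonzero when x'' = 0. *)
pose c : K := `|x''| + 1.
have c0 : 0 < c by rewrite ltr_wpDl.
rewrite -(scalerKV (lt0r_neq0 c0) x'') -[_ *: _]addr0.
apply: representedDl (represented0l _ _); apply: represented_of_precompact wap.
rewrite normrZ normfV gtr0_norm// mulrC ler_pdivrMr// mul1r.
by rewrite lerDl.
Qed.

Lemma left_topological_centreP (X Y : normedModType K)
    (act : bounded_bilinear X Y Y) x'' :
  left_topological_centre (arens act) x'' <-> forall y', represented act x'' y'.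
Proof.
split=> [xc y'|rep].
  apply: (@weak_star_continuous_functional R k (dual Y)
    (fun y'' => arens act x'' y'' y')).
    by move=> a u v; rewrite linearPr.
  move=> y''; apply: (@continuous_comp (weak_star_space (dual Y))
    (weak_star_space (dual Y)) K^o (arens act x'') (fun g => g y')).
    exact: xc.
  exact: weak_star_eval_continuous.
apply: continuous_to_weak_star => y'; have [u uE] := rep y'.
have -> : (fun t : weak_star_space (dual Y) => arens act x'' t y' : K^o) =
    (fun t : weak_star_space (dual Y) => (t : dual (dual Y)) u).
  by apply/funext => t; exact: uE.
exact: weak_star_eval_continuous.
Qed.

(** * Associativity through the Arens extension *)

Definition associative_action (X Y : normedModType K)
    (mul : bounded_bilinear X X X) (act : bounded_bilinear X Y Y) : Prop :=
  forall a x y, act a (act x y) = act (mul a x) y.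

Section action.
Variables X Y : normedModType K.
Variables (mul : bounded_bilinear X X X) (act : bounded_bilinear X Y Y).
Hypothesis actA : associative_action mul act.

(** Tested on vectors, this is the associativity of the action. Associativity of
    the Arens extension comes from it by two further dualizations. *)
Lemma adjoint_action y'' y' a :
  adjoint mul (adjoint (adjoint act) y'' y') a =
  adjoint (adjoint act) y'' (adjoint act y' a).
Proof.
apply: dual_eqP => x.
rewrite -[LHS]/(y'' (adjoint act y' (mul a x))).
rewrite -[RHS]/(y'' (adjoint act (adjoint act y' a) x)).
by congr (y'' _); apply: dual_eqP => y; rewrite !adjointE actA.
Qed.

Lemma arens_action : associative_action (arens mul) (arens act).
Proof.
move=> a'' x'' y''; apply: dual_eqP => y'.
rewrite -[LHS]/(a'' (adjoint (adjoint act) (arens act x'' y'') y')).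
rewrite -[RHS]/(a'' (adjoint (adjoint mul) x'' (adjoint (adjoint act) y'' y'))).
congr (a'' _); apply: dual_eqP => a.
rewrite -[RHS]/(x'' (adjoint mul (adjoint (adjoint act) y'' y') a)).
by rewrite adjoint_action.
Qed.

(** This exchanges the two sides of the equivalence: the factor a passes from
    the centre to the almost periodic functionals. *)
Lemma represented_mul a x'' y' :
  represented act (arens mul (bidual_embedding a) x'') y' <->
  represented act x'' (adjoint act y' a).
Proof.
have E y'' : arens act (arens mul (bidual_embedding a) x'') y'' y' =
    arens act x'' y'' (adjoint act y' a).
  by rewrite -arens_action.
by split=> -[z zE]; exists z => y''; rewrite -zE E.
Qed.

End action.

Lemma iter_arens_action (X Y : normedModType K) (mul : bounded_bilinear X X X)
    (act : bounded_bilinear X Y Y) (j : nat) : associative_action mul act ->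
  associative_action (iter_arens mul j) (iter_arens act j).
Proof. by move=> actA; elim: j => //= j; exact: arens_action. Qed.
End represented.

(** * The theorem *)

(* The even integer n of the theorem is j.*2. *)
Theorem theorem2p4 (R : realType) (k : scalar_kind)
    (A : completeNormedModType (scalar_field R k)) (mul : banach_algebra A)
    (B : completeNormedModType (scalar_field R k)) (bim : banach_bimodule mul B)
    (j : nat) :
  let mul_n := iter_arens mul j in
  let lact_n := iter_arens (lact bim) j in
  let mul_n2 := arens mul_n in
  let lact_n2 := arens lact_n in
  let A_n := range (@bidual_embedding R k (iter_dual A j.*2)) in
  let Z_n2 := left_topological_centre lact_n2 in
  (span_product (adjoint lact_n) setT setT `<=` wap_left lact_n <->
   span_product mul_n2 A_n setT `<=` Z_n2) /\
  (span_product mul_n2 A_n setT `<=` span_product mul_n2 A_n Z_n2 ->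
   span_product mul_n2 A_n setT `<=` Z_n2).
Proof.
move=> mul_n lact_n mul_n2 lact_n2 A_n Z_n2.
have actA : associative_action mul_n lact_n.
  by apply: iter_arens_action => a x y; exact: lactA.
have span_centre (S : set (dual (dual (iter_dual A j.*2)))) :
    S `<=` Z_n2 -> linear_span S `<=` Z_n2.
  apply: linear_span_sub => [|a u v].
    by apply/left_topological_centreP => y'; exact: represented0l.
  move=> /left_topological_centreP Zu /left_topological_centreP Zv.
  by apply/left_topological_centreP => y'; exact: representedDl.
have span_wap (S : set (dual (iter_dual B j.*2))) :
    S `<=` wap_left lact_n -> linear_span S `<=` wap_left lact_n.
  apply: linear_span_sub => [|a u v].
    by apply/wap_leftP => x''; exact: represented0r.
  move=> /wap_leftP wu /wap_leftP wv.
  by apply/wap_leftP => x''; exact: representedDr.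
have sub_span (V : lmodType (scalar_field R k)) (S : set V) v :
    S v -> linear_span S v.
  move=> Sv; exists 1, (fun=> 1), (fun=> v); split => //.
  by rewrite big_ord1 scale1r.
split; [split|].
- move=> wap; apply: span_centre => _ [_ [a _ <-] [x'' _ <-]].
  apply/left_topological_centreP => y'; apply/(represented_mul actA).
  apply: (wap_leftP _ _).1; apply/wap/sub_span.
  by exists y' => //; exists a.
- move=> centre; apply: span_wap => _ [y' _ [a _ <-]].
  apply/wap_leftP => x''; apply/(represented_mul actA).
  apply: (left_topological_centreP _ _).1; apply/centre/sub_span.
  by exists (bidual_embedding a); [exists a|exists x''].
- move=> sub; apply: (subset_trans sub).
  apply: span_centre => _ [_ [a _ <-] [z /left_topological_centreP Zz <-]].
  by apply/left_topological_centreP => y'; apply/(represented_mul actA).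
Qed.
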